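(* Let $n\in\mathbb N$, $n\geq 2$, be fixed, let $\lambda=\frac{n-1}{2}$, and let $$G_0:=\sum_{l=1}^\infty\frac{1}{l^2(l+2\lambda)^2}\,\frac{\lambda+l}{\lambda}\,\mathcal C_l^\lambda .$$ Then $$G_0(\cos\vartheta)=\frac{1}{4\lambda^2}\,(J_0+J_{2\lambda})-\frac{1}{4\lambda^3}\,(I_0-I_{2\lambda})$$ for $$I_k=\int_0^1 r^{k-1}\left[\Sigma_n\, p_r^\lambda(\cos\vartheta)-1\right]dr,$$ $$J_k=\int_0^1\left(\frac{1}{R}\int_0^R r^{k-1}\left[\Sigma_n\, p_r^\lambda(\cos\vartheta)-1\right]dr\right)dR.$$
   Context: $\mathcal C_l^\lambda$ denotes the Gegenbauer polynomial of degree $l$ and order $\lambda$ (standard normalization, generating function $\sum_{l\ge0}\mathcal C_l^\lambda(t)r^l=(1-2tr+r^2)^{-\lambda}$). $\Sigma_n=\frac{2\pi^{(n+1)/2}}{\Gamma((n+1)/2)}$ is the surface measure of the unit sphere $\mathcal S^n\subseteq\mathbb R^{n+1}$. The Poisson kernel on $\mathcal S^n$ is, for $r\in[0,1)$, $$p_r^\lambda(\cos\vartheta)=\frac{1}{\Sigma_n}\sum_{l=0}^\infty r^l\,\frac{\lambda+l}{\lambda}\,\mathcal C_l^\lambda(\cos\vartheta)=\frac{1}{\Sigma_n}\,\frac{1-r^2}{(1-2r\cos\vartheta+r^2)^{(n+1)/2}}.$$ Zonal functions on $\mathcal S^n$ are those depending only on the first hyperspherical coordinate $\vartheta$ (where $x_1=\cos\vartheta$);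 they are identified with functions of $t=\cos\vartheta$.
   Formalization: The series for G_0 diverges pointwise for large n (e.g. n=9, ϑ=π/2), so G_0(cos ϑ) is taken as its Abel sum, and as the ordinary sum wherever the series converges; ϑ=0 is excluded because the integrals I_k and J_k diverge there. *)

(* Defs.v *)
From Stdlib Require Import Reals Factorial.
From Coquelicot Require Import Coquelicot.

Local Open Scope R_scope.

(** Taylor coefficient of order [l] at [r = 0] of the generating function
    [(1 - 2 t r + r^2)^(-lam)]. *)
Definition gegenbauer (lam : R) (l : nat) (t : R) : R :=
  Derive_n (fun r => Rpower (1 - 2 * t * r + r ^ 2) (- lam)) l 0
  / INR (fact l).

Definition Gamma (s : R) : R :=
  RInt_gen (fun x => Rpower x (s - 1) * exp (- x))
    (at_right 0) (Rbar_locally p_infty).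

Definition sphere_area (n : nat) : R :=
  2 * Rpower PI ((INR n + 1) / 2) / Gamma ((INR n + 1) / 2).

Definition lambda (n : nat) : R := (INR n - 1) / 2.

(** Only meaningful for [0 <= r < 1], where the series converges. *)
Definition poisson (n : nat) (r t : R) : R :=
  / sphere_area n *
  Series (fun l => r ^ l * ((lambda n + INR l) / lambda n)
                   * gegenbauer (lambda n) l t).

(** [Rpower 0 _] and [poisson n 1 t] are junk values; each occurs at a single
    endpoint of integration only, so they affect neither the existence nor the
    value of the Riemann integrals below. *)
Definition I_integrand (n : nat) (k t r : R) : R :=
  Rpower r (k - 1) * (sphere_area n * poisson n r t - 1).

Definition I_int (n : nat) (k t : R) : R := RInt (I_integrand n k t) 0 1.

Definition J_integrand (n : nat) (k t rho : R) : R :=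
  1 / rho * RInt (I_integrand n k t) 0 rho.

Definition J_int (n : nat) (k t : R) : R := RInt (J_integrand n k t) 0 1.

(** Terms at [t] of the Gegenbauer series defining [G_0], which starts at
    [l = 1]. *)
Definition G0_term (n : nat) (t : R) (l : nat) : R :=
  match l with
  | O => 0
  | S _ =>
      1 / (INR l ^ 2 * (INR l + 2 * lambda n) ^ 2)
      * ((lambda n + INR l) / lambda n) * gegenbauer (lambda n) l t
  end.

Definition is_abel_sum (a : nat -> R) (s : R) : Prop :=
  (forall x, 0 <= x < 1 -> ex_pseries a x) /\
  filterlim (PSeries a) (at_left 1) (locally s).

(** [s] is the value at [t] of the function given by the Gegenbauer series
    [G_0].  As [gegenbauer (lambda n) l (cos theta)] oscillates with amplitude
    of order [l ^ (lambda n - 1)], the partial sums diverge for large [n] (at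
    every [0 < theta < PI] as soon as [9 <= n]), although the series is the
    Gegenbauer expansion of an integrable zonal function, continuous off the
    pole [t = 1].  The value of that function is the limit of its Poisson means,
    i.e. the Abel sum; the second conjunct says that [s] is the ordinary sum
    wherever the series does converge. *)
Definition is_G0_value (n : nat) (t s : R) : Prop :=
  is_abel_sum (G0_term n t) s /\
  (forall s', is_series (G0_term n t) s' -> s' = s).

(* Main.v *)
Require Import Defs.
From Stdlib Require Import Reals Lra Lia Psatz.
From Coquelicot Require Import Coquelicot.

Local Open Scope R_scope.

(** Write [t = cos theta] and let [w l = (lam + l) / lam * C_l(t)] be the
    coefficients of the Poisson kernel, so that for [0 <= r < 1] the bracket
    [Sigma_n p_r(t) - 1] is [sum_(l >= 1) w l r^l].  Integrating it term by term
    against [r^(k-1)] turns [w l] into [w l / (l + k)], which gives [I_k]; dividing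
    the partial integral by its upper bound and integrating again gives
    [w l / (l + k)^2], hence [J_k].  The formula is then the partial fraction
    decomposition
<<
      1             1    (  1        1       )      1    ( 1      1    )
  ------------- = ------ ( --- + ----------- ) - ------- ( - - ------- )
  l^2 (l+2lam)^2  4lam^2 ( l^2   (l+2lam)^2  )   4 lam^3 ( l   l+2lam  )
>>
    applied to each term.  The series need not converge at [r = 1], so every
    identity is carried by Abel sums: if [a] has Abel sum [L], that is, if
    [PSeries a] tends to [L] at [1], then [r^k * PSeries a r] extends
    continuously to [r = 1], its integral over [[0, 1]] exists, and this integral
    is the Abel sum of [a j / (j + k + 1)] ([abel_sum_integrated]).  Applying this
    twice needs one analytic input only: a finite limit at [r = 1] for the
    bracket divided by [r].  As [2 * lam = n - 1] is a natural number, both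
    values of [k] give genuine power series.

    That limit comes from the closed form of the Poisson kernel,
    [(1 - r^2) (1 - 2 t r + r^2)^(- lam - 1)], which vanishes at [r = 1] because
    [t < 1] keeps the denominator away from [0].  The closed form follows from
    the generating function by applying [1 + (r / lam) d/dr].

    The Gegenbauer polynomials being Taylor coefficients at [0], the generating
    function has to be shown to be the sum of its Taylor series on the whole of
    [(-1, 1)].  For this, factor [1 - 2 t r + r^2] as the squared modulus of
    [1 - r exp(i theta)].  The binomial series of [(1 - r exp(i theta))^(- lam)]
    has real part [A] and imaginary part [B], both of radius at least [1], and
    [A^2 + B^2] is a power series that solves the first-order equation
    characterizing [(1 - 2 t r + r^2)^(- lam)] ([binomial_modulus]).

    Finally [sphere_area n] cancels against its inverse because it is nonzero,
    which rests on the convergence of the Gamma integral. *)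

(** * Power series on the unit disk and Abel sums *)

(** Radius of convergence at least [1], in the form in which power series lemmas
    take it as a hypothesis. *)
Definition cv_on_disk (a : nat -> R) : Prop :=
  forall x, Rabs x < 1 -> Rbar_lt (Rabs x) (CV_radius a).

Lemma cv_on_disk_of_segment (a : nat -> R) :
  (forall x, 0 <= x < 1 -> ex_pseries a x) -> cv_on_disk a.
Proof.
  intros Ha x Hx.
  (* Otherwise the terms could not tend to 0 at a point between |x| and 1. *)
  destruct (Rbar_lt_dec (Rabs x) (CV_radius a)) as [H | H]; [exact H | exfalso].
  apply Rbar_not_lt_le in H.
  assert (Hp := Rabs_pos x).
  set (y := (1 + Rabs x) / 2).
  assert (Hy : 0 <= y < 1) by (unfold y; lra).
  assert (Hxy : Rbar_lt (CV_radius a) (Rabs y)).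
  { apply Rbar_le_lt_trans with (1 := H); simpl.
    rewrite (Rabs_pos_eq y) by lra. unfold y; lra. }
  apply (CV_disk_outside a y Hxy).
  apply is_lim_seq_ext with (fun k => scal (pow_n y k) (a k)).
  { intro k. rewrite pow_n_pow. apply Rmult_comm. }
  apply ex_series_lim_0, (Ha y Hy).
Qed.

Lemma cv_on_disk_le (a b : nat -> R) :
  (forall k, Rabs (b k) <= Rabs (a k)) -> cv_on_disk a -> cv_on_disk b.
Proof.
  intros Hab Ha. apply cv_on_disk_of_segment. intros x Hx.
  assert (Hx' : Rabs x < 1) by (rewrite Rabs_pos_eq; lra).
  apply (@ex_series_le R_AbsRing R_CompleteNormedModule) with (fun k => Rabs (a k * x ^ k)).
  - intro k. rewrite pow_n_pow. change (Rabs (x ^ k * b k) <= Rabs (a k * x ^ k)).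
    rewrite !Rabs_mult, Rmult_comm.
    apply Rmult_le_compat_r; [apply Rabs_pos | apply Hab].
  - apply CV_disk_inside, Ha, Hx'.
Qed.

(** Each [x^k] is an eigenvector of the Euler operator [mu + x d/dx].  This gives the differential equation of the binomial series, the
    Poisson kernel out of the generating function, and the inverse of the
    integration of [r^(mu - 1)] times a power series. *)
Lemma is_pseries_euler (a : nat -> R) (mu x : R) :
  Rbar_lt (Rabs x) (CV_radius a) ->
  is_pseries (fun k => (mu + INR k) * a k) x
    (mu * PSeries a x + x * PSeries (PS_derive a) x).
Proof.
  intro Hx.
  apply is_pseries_ext
    with (PS_plus (PS_scal mu a) (PS_incr_1 (PS_derive a))).
  { intros [|k]; unfold PS_plus, PS_scal, PS_incr_1, PS_derive;
      change plus with Rplus; change scal with Rmult; change zero with 0;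
      match goal with |- ?u = ?v => change (@eq R u v) end;
      [simpl INR|]; ring. }
  apply (is_pseries_plus (PS_scal mu a) (PS_incr_1 (PS_derive a)) x
           (mu * PSeries a x) (x * PSeries (PS_derive a) x)).
  - apply (is_pseries_scal mu a x); [apply Rmult_comm|].
    apply PSeries_correct, CV_radius_inside, Hx.
  - apply (is_pseries_incr_1 (PS_derive a)), PSeries_correct, ex_pseries_derive, Hx.
Qed.

(** Abel's theorem when the radius of convergence is exactly [1]; for a larger
    radius the power series is simply continuous at [1]. *)
Lemma abel_sum_of_series (a : nat -> R) (s s' : R) :
  is_abel_sum a s -> is_series a s' -> s' = s.
Proof.
  intros [Hex Hlim] Hs.
  assert (Hd := cv_on_disk_of_segment a Hex).
  assert (H1 : is_pseries a 1 s').
  { apply is_series_ext with (2 := Hs). intro k.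
    rewrite pow_n_pow, pow1. change scal with Rmult. simpl; ring. }
  assert (E1 : PSeries a 1 = s') by (apply is_pseries_unique, H1).
  apply (filterlim_locally_unique (F := at_left 1) (PSeries a)); [|exact Hlim].
  rewrite <- E1.
  destruct (Rbar_lt_dec 1 (CV_radius a)) as [H | H].
  - apply (filterlim_filter_le_1 (F := locally 1)); [apply filter_le_within|].
    apply continuity_pt_filterlim, PSeries_continuity.
    rewrite Rabs_R1. exact H.
  - assert (E : CV_radius a = 1).
    { apply Rbar_le_antisym; [apply Rbar_not_lt_le, H|].
      apply Rbar_not_lt_le. intro H'.
      assert (H0 := CV_radius_ge_0 a). unfold cv_on_disk in Hd.
      destruct (CV_radius a) as [r| |]; simpl in *; try easy.
      specialize (Hd r). rewrite Rabs_pos_eq in Hd by lra.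
      simpl in Hd. lra. }
    assert (HA := Abel a). rewrite E in HA. apply HA.
    + simpl; lra.
    + exact I.
    + exists s'. exact H1.
Qed.

Lemma at_left_1_interval (P : R -> Prop) :
  (forall x, 0 < x < 1 -> P x) -> at_left 1 P.
Proof.
  intro HP. exists (mkposreal 1 Rlt_0_1). intros y Hy Hy1. apply HP.
  change (Rabs (y - 1) < 1) in Hy. apply Rabs_def2 in Hy. lra.
Qed.

Lemma filterlim_at_left_mult (h f : R -> R) (l : R) :
  continuous h 1 -> filterlim f (at_left 1) (locally l) ->
  filterlim (fun x => h x * f x) (at_left 1) (locally (h 1 * l)).
Proof.
  intros Hh Hf.
  apply (filterlim_comp_2 (G := locally (h 1)) (H := locally l) h f Rmult).
  - exact (filterlim_filter_le_1 h (filter_le_within _) Hh).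
  - exact Hf.
  - apply (filterlim_mult (h 1) l).
Qed.

Lemma is_abel_sum_ext (a b : nat -> R) (s : R) :
  (forall k, a k = b k) -> is_abel_sum a s -> is_abel_sum b s.
Proof.
  intros Hab [Hex Hlim]. split.
  - intros x Hx. destruct (Hex x Hx) as [l Hl]. exists l.
    apply is_pseries_ext with (1 := Hab) (2 := Hl).
  - apply filterlim_ext with (2 := Hlim). intro x. apply PSeries_ext, Hab.
Qed.

Lemma is_abel_sum_linear (a b : nat -> R) (s s' u v : R) :
  is_abel_sum a s -> is_abel_sum b s' ->
  is_abel_sum (fun k => u * a k + v * b k) (u * s + v * s').
Proof.
  intros [Ha La] [Hb Lb].
  assert (Hu : forall (w : R) (c : nat -> R) (x : R),
            ex_pseries c x -> ex_pseries (PS_scal w c) x)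
    by (intros w c x; apply (ex_pseries_scal w c x), Rmult_comm).
  split.
  - intros x Hx.
    exact (ex_pseries_plus _ _ _ (Hu u a x (Ha x Hx)) (Hu v b x (Hb x Hx))).
  - apply filterlim_ext_loc with (fun x => u * PSeries a x + v * PSeries b x).
    + apply at_left_1_interval. intros x Hx.
      rewrite <- !PSeries_scal. symmetry.
      apply (PSeries_plus (PS_scal u a) (PS_scal v b)); apply Hu;
        [apply Ha | apply Hb]; lra.
    + apply (filterlim_comp_2 (G := locally (u * s)) (H := locally (v * s'))
               (fun x => u * PSeries a x) (fun x => v * PSeries b x) Rplus).
      * apply (filterlim_at_left_mult (fun _ => u)); [apply continuous_const|exact La].
      * apply (filterlim_at_left_mult (fun _ => v)); [apply continuous_const|exact Lb].
      * apply (filterlim_plus (u * s) (v * s')).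
Qed.

Lemma is_abel_sum_incr_1 (a : nat -> R) (s : R) :
  is_abel_sum a s -> is_abel_sum (PS_incr_1 a) s.
Proof.
  intros [Ha La]. split.
  - intros x Hx. apply (ex_pseries_incr_1 a x), Ha, Hx.
  - apply filterlim_ext with (fun x => x * PSeries a x).
    { intro x. symmetry. apply PSeries_incr_1. }
    rewrite <- (Rmult_1_l s).
    apply (filterlim_at_left_mult (fun x => x)); [apply continuous_id|exact La].
Qed.

(** * Integrating a power series up to the boundary *)

Lemma cv_on_disk_div (a : nat -> R) (k : nat) :
  cv_on_disk a -> cv_on_disk (fun j => a j / (INR k + 1 + INR j)).
Proof.
  apply cv_on_disk_le. intro j. unfold Rdiv. rewrite Rabs_mult.
  assert (H1 := pos_INR k). assert (H2 := pos_INR j).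
  rewrite <- (Rmult_1_r (Rabs (a j))) at 2.
  apply Rmult_le_compat_l; [apply Rabs_pos|].
  rewrite Rabs_pos_eq.
  - rewrite <- Rinv_1. apply Rinv_le_contravar; lra.
  - left. apply Rinv_0_lt_compat; lra.
Qed.

(** Dividing the coefficients by [k + 1 + j] inverts the Euler operator, so
    that multiplication by [r^(k+1)] afterwards produces a primitive of
    [r^k * PSeries a r]. *)
Lemma is_derive_monomial_PSeries (a : nat -> R) (k : nat) (x : R) :
  cv_on_disk a -> Rabs x < 1 ->
  is_derive (fun r => r ^ S k * PSeries (fun j => a j / (INR k + 1 + INR j)) r)
    x (x ^ k * PSeries a x).
Proof.
  intros Ha Hx.
  set (b := fun j => a j / (INR k + 1 + INR j)).
  assert (Hpos : forall j, 1 <= INR k + 1 + INR j).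
  { intro j. assert (H1 := pos_INR k). assert (H2 := pos_INR j). lra. }
  assert (Hb : cv_on_disk b) by apply cv_on_disk_div, Ha.
  assert (E : PSeries a x
              = (INR k + 1) * PSeries b x + x * PSeries (PS_derive b) x).
  { rewrite <- (is_pseries_unique _ _ _ (is_pseries_euler b (INR k + 1) x (Hb x Hx))).
    apply PSeries_ext. intro j. unfold b. specialize (Hpos j). field. lra. }
  rewrite E.
  replace (x ^ k * _) with
    ((INR (S k) * 1 * x ^ k) * PSeries b x
      + x ^ S k * PSeries (PS_derive b) x)
    by (rewrite S_INR; simpl; ring).
  apply (is_derive_mult (fun r => r ^ S k) (PSeries b)).
  - apply (is_derive_pow (fun r => r) (S k) x 1). exact (is_derive_id x).
  - apply is_derive_PSeries, Hb, Hx.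
  - apply Rmult_comm.
Qed.

(** Term-by-term integration up to the boundary of the disk.  Inside the disk the
    primitive is a power series; the Abel limit extends the integrand to a
    function [g] continuous at [1], whose integral depends continuously on its
    upper bound.  Only the values of [f] in the open interval matter, which
    absorbs the arbitrary values of the integrands at the endpoints. *)
Lemma abel_sum_integrated (a : nat -> R) (L : R) (k : nat) (f : R -> R) :
  is_abel_sum a L ->
  (forall r, 0 < r < 1 -> f r = r ^ k * PSeries a r) ->
  let b := fun j => a j / (INR k + 1 + INR j) in
  ex_RInt f 0 1
  /\ (forall x, 0 < x < 1 -> RInt f 0 x = x ^ S k * PSeries b x)
  /\ is_abel_sum b (RInt f 0 1).
Proof.
  intros [Hex Hlim] Hf b.
  assert (Ha := cv_on_disk_of_segment a Hex).
  assert (Hcont : forall c, -1 < c < 1 ->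
            continuous (fun r => r ^ k * PSeries a r) c).
  { intros c Hc. apply (continuous_mult (fun r => r ^ k) (PSeries a)).
    - apply continuity_pt_filterlim, derivable_continuous_pt, derivable_pt_pow.
    - apply continuity_pt_filterlim, PSeries_continuity, Ha, Rabs_def1; lra. }
  destruct (C0_extension_right (fun r => r ^ k * PSeries a r) (1 ^ k * L) (-1) 1)
    as [g [Hg [Hgf _]]].
  { lra. }
  { exact Hcont. }
  { apply (filterlim_at_left_mult (fun r => r ^ k)); [|exact Hlim].
    apply continuity_pt_filterlim, derivable_continuous_pt, derivable_pt_pow. }
  assert (Hgint : forall x, 0 < x -> ex_RInt g 0 x).
  { intros x Hx. apply (ex_RInt_continuous (V := R_CompleteNormedModule)). intros z Hz.
    rewrite Rmin_left in Hz by lra. apply Hg. lra. }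
  assert (Hfg : forall x, 0 < x <= 1 ->
            forall r, Rmin 0 x < r < Rmax 0 x -> g r = f r).
  { intros x Hx r. rewrite Rmin_left, Rmax_right by lra. intro Hr.
    rewrite Hgf, Hf by lra. reflexivity. }
  assert (Hgx : forall x, 0 < x < 1 -> RInt g 0 x = x ^ S k * PSeries b x).
  { intros x Hx. apply is_RInt_unique.
    apply is_RInt_ext with (fun r => r ^ k * PSeries a r).
    { intro r. rewrite Rmin_left, Rmax_right by lra. intro Hr.
      symmetry. apply Hgf; lra. }
    replace (x ^ S k * PSeries b x)
      with (minus (x ^ S k * PSeries b x) (0 ^ S k * PSeries b 0))
      by (change (x ^ S k * PSeries b x - 0 ^ S k * PSeries b 0
                  = x ^ S k * PSeries b x); simpl; ring).
    apply (is_RInt_derive (fun r => r ^ S k * PSeries b r)).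
    - intros r. rewrite Rmin_left, Rmax_right by lra. intro Hr.
      apply is_derive_monomial_PSeries; [exact Ha|]. apply Rabs_def1; lra.
    - intros r. rewrite Rmin_left, Rmax_right by lra. intro Hr.
      apply Hcont; lra. }
  repeat split.
  - apply ex_RInt_ext with (2 := Hgint 1 Rlt_0_1). apply Hfg; lra.
  - intros x Hx. rewrite <- Hgx by exact Hx.
    apply RInt_ext. intros r Hr. symmetry. apply (Hfg x); [lra|exact Hr].
  - intros x Hx. apply CV_radius_inside.
    apply (cv_on_disk_div a k Ha). rewrite Rabs_pos_eq; lra.
  - rewrite <- (RInt_ext g f 0 1) by (apply Hfg; lra).
    replace (RInt g 0 1) with (/ (1 ^ S k) * RInt g 0 1)
      by (rewrite pow1; field).
    apply filterlim_ext_loc with (fun x => / (x ^ S k) * RInt g 0 x).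
    + apply at_left_1_interval. intros x Hx. rewrite Hgx by exact Hx.
      field. apply pow_nonzero. lra.
    + apply (filterlim_at_left_mult (fun x => / (x ^ S k))).
      * apply continuity_pt_filterlim, continuity_pt_inv.
        -- apply derivable_continuous_pt, derivable_pt_pow.
        -- apply pow_nonzero. lra.
      * apply (filterlim_filter_le_1 (F := locally 1)); [apply filter_le_within|].
        apply (continuous_RInt_1 g 0 1 (fun z => RInt g 0 z)).
        exists (mkposreal 1 Rlt_0_1). intros z Hz.
        change (Rabs (z - 1) < 1) in Hz. apply Rabs_def2 in Hz.
        apply (RInt_correct g), Hgint. lra.
Qed.

(** * The Gegenbauer generating function *)

(** The coefficients [lam (lam + 1) ... (lam + k - 1) / k!] of
    [(1 - z)^(- lam)]. *)
Fixpoint binomial_coef (lam : R) (k : nat) : R :=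
  match k with
  | O => 1
  | S j => binomial_coef lam j * ((lam + INR j) / INR (S j))
  end.

Lemma cv_on_disk_binomial (lam : R) : 0 < lam -> cv_on_disk (binomial_coef lam).
Proof.
  intros Hlam x Hx.
  assert (Hpos : forall k, 0 < binomial_coef lam k).
  { induction k as [|k IH]; [simpl; lra|].
    change (0 < binomial_coef lam k * ((lam + INR k) / INR (S k))).
    assert (H := pos_INR k). assert (H' := lt_0_INR (S k) (Nat.lt_0_succ k)).
    apply Rmult_lt_0_compat, Rdiv_lt_0_compat; lra. }
  rewrite (CV_radius_finite_DAlembert _ 1).
  - rewrite Rinv_1. exact Hx.
  - intro k. apply Rgt_not_eq, Hpos.
  - lra.
  - apply is_lim_seq_ext with (fun k => 1 + (lam - 1) * / INR (S k)).
    + intro k. specialize (Hpos k).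
      assert (H := pos_INR k). assert (H' := lt_0_INR (S k) (Nat.lt_0_succ k)).
      rewrite Rabs_pos_eq.
      * change (binomial_coef lam (S k))
          with (binomial_coef lam k * ((lam + INR k) / INR (S k))).
        rewrite S_INR in *. field; lra.
      * change (binomial_coef lam (S k))
          with (binomial_coef lam k * ((lam + INR k) / INR (S k))).
        left. apply Rdiv_lt_0_compat; [|exact Hpos].
        apply Rmult_lt_0_compat, Rdiv_lt_0_compat; lra.
    + replace (Finite 1) with (Rbar_plus 1 (Rbar_mult (lam - 1) 0))
        by (simpl; f_equal; ring).
      apply is_lim_seq_plus'; [apply is_lim_seq_const|].
      apply is_lim_seq_mult'; [apply is_lim_seq_const|].
      apply (is_lim_seq_incr_1 (fun k => / INR k)).
      replace (Finite 0) with (Rbar_inv p_infty) by reflexivity.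
      apply is_lim_seq_inv; [apply is_lim_seq_INR|easy].
Qed.

(** Real and imaginary parts of the coefficients of
    [(1 - r exp(i theta))^(- lam)] as a power series in [r]. *)
Definition binomial_cos (lam theta : R) (k : nat) : R :=
  binomial_coef lam k * cos (INR k * theta).
Definition binomial_sin (lam theta : R) (k : nat) : R :=
  binomial_coef lam k * sin (INR k * theta).

Lemma cv_on_disk_binomial_cos (lam theta : R) :
  0 < lam -> cv_on_disk (binomial_cos lam theta).
Proof.
  intro Hlam. apply cv_on_disk_le with (2 := cv_on_disk_binomial lam Hlam).
  intro k. unfold binomial_cos. rewrite Rabs_mult, <- Rmult_1_r.
  apply Rmult_le_compat_l; [apply Rabs_pos|]. apply Rabs_le, COS_bound.
Qed.

Lemma cv_on_disk_binomial_sin (lam theta : R) :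
  0 < lam -> cv_on_disk (binomial_sin lam theta).
Proof.
  intro Hlam. apply cv_on_disk_le with (2 := cv_on_disk_binomial lam Hlam).
  intro k. unfold binomial_sin. rewrite Rabs_mult, <- Rmult_1_r.
  apply Rmult_le_compat_l; [apply Rabs_pos|]. apply Rabs_le, SIN_bound.
Qed.

(** Real and imaginary parts of
    [Z' = exp(i theta) (lam Z + x Z')], where [Z = A + i B]: the equation
    [(1 - z) u' = lam u] of [u = (1 - z)^(- lam)] read along the ray
    [z = x exp(i theta)].  On coefficients it is
    [(k + 1) a_(k+1) = (lam + k) a_k] together with the addition formulas. *)
Lemma binomial_rotation_ode (lam theta x : R) :
  0 < lam -> Rabs x < 1 ->
  let A := PSeries (binomial_cos lam theta) x in
  let B := PSeries (binomial_sin lam theta) x in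
  let A' := PSeries (PS_derive (binomial_cos lam theta)) x in
  let B' := PSeries (PS_derive (binomial_sin lam theta)) x in
  A' = cos theta * (lam * A + x * A') - sin theta * (lam * B + x * B') /\
  B' = sin theta * (lam * A + x * A') + cos theta * (lam * B + x * B').
Proof.
  intros Hlam Hx A B A' B'.
  assert (HA := is_pseries_euler _ lam x
                  (cv_on_disk_binomial_cos lam theta Hlam x Hx)).
  assert (HB := is_pseries_euler _ lam x
                  (cv_on_disk_binomial_sin lam theta Hlam x Hx)).
  fold A A' in HA. fold B B' in HB.
  assert (Hstep : forall k, INR (S k) * binomial_coef lam (S k)
                            = (lam + INR k) * binomial_coef lam k).
  { intro k. change (binomial_coef lam (S k))
      with (binomial_coef lam k * ((lam + INR k) / INR (S k))).
    assert (H' := lt_0_INR (S k) (Nat.lt_0_succ k)). field. lra. }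
  split.
  - apply is_pseries_unique.
    apply is_pseries_ext with
      (PS_plus (PS_scal (cos theta) (fun k => (lam + INR k) * binomial_cos lam theta k))
               (PS_scal (- sin theta) (fun k => (lam + INR k) * binomial_sin lam theta k))).
    + intro k. change (cos theta * ((lam + INR k) * binomial_cos lam theta k)
        + - sin theta * ((lam + INR k) * binomial_sin lam theta k)
        = INR (S k) * binomial_cos lam theta (S k)).
      unfold binomial_cos, binomial_sin.
      replace (INR (S k) * theta) with (INR k * theta + theta) by (rewrite S_INR; ring).
      rewrite <- (Rmult_assoc (INR (S k))), (Hstep k), cos_plus.
      ring.
    + replace (_ - _) with (cos theta * (lam * A + x * A')
        + - sin theta * (lam * B + x * B')) by ring.
      apply (is_pseries_plus (K := R_AbsRing) (V := R_NormedModule)).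
      * apply (is_pseries_scal (cos theta) _ x _ (Rmult_comm _ _) HA).
      * apply (is_pseries_scal (- sin theta) _ x _ (Rmult_comm _ _) HB).
  - apply is_pseries_unique.
    apply is_pseries_ext with
      (PS_plus (PS_scal (sin theta) (fun k => (lam + INR k) * binomial_cos lam theta k))
               (PS_scal (cos theta) (fun k => (lam + INR k) * binomial_sin lam theta k))).
    + intro k. change (sin theta * ((lam + INR k) * binomial_cos lam theta k)
        + cos theta * ((lam + INR k) * binomial_sin lam theta k)
        = INR (S k) * binomial_sin lam theta (S k)).
      unfold binomial_cos, binomial_sin.
      replace (INR (S k) * theta) with (INR k * theta + theta) by (rewrite S_INR; ring).
      rewrite <- (Rmult_assoc (INR (S k))), (Hstep k), sin_plus.
      ring.
    + apply (is_pseries_plus (K := R_AbsRing) (V := R_NormedModule)).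
      * apply (is_pseries_scal (sin theta) _ x _ (Rmult_comm _ _) HA).
      * apply (is_pseries_scal (cos theta) _ x _ (Rmult_comm _ _) HB).
Qed.

Lemma poisson_denominator_pos (t x : R) :
  -1 <= t <= 1 -> Rabs x < 1 -> 0 < 1 - 2 * t * x + x ^ 2.
Proof.
  intros Ht Hx.
  assert (H : t * x <= Rabs x).
  { apply Rle_trans with (1 := Rle_abs _). rewrite Rabs_mult.
    rewrite <- (Rmult_1_l (Rabs x)) at 2.
    apply Rmult_le_compat_r; [apply Rabs_pos | apply Rabs_le, Ht]. }
  rewrite <- (pow2_abs x).
  assert (H' : 0 < (1 - Rabs x) ^ 2) by (apply pow_lt; lra).
  lra.
Qed.

(** With [Z = A + i B] and [D = |1 - x exp(i theta)|^2], the previous equation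
    gives [D * (|Z|^2)' = 2 lam (cos theta - x) |Z|^2], hence [|Z|^2 * D^lam]
    is constant. *)
Lemma binomial_modulus (lam theta x : R) :
  0 < lam -> Rabs x < 1 ->
  PSeries (binomial_cos lam theta) x ^ 2 + PSeries (binomial_sin lam theta) x ^ 2
  = Rpower (1 - 2 * cos theta * x + x ^ 2) (- lam).
Proof.
  intros Hlam.
  set (A := PSeries (binomial_cos lam theta)).
  set (B := PSeries (binomial_sin lam theta)).
  set (D := fun r => 1 - 2 * cos theta * r + r ^ 2).
  set (F := fun r => (A r ^ 2 + B r ^ 2) * Rpower (D r) lam).
  assert (HD : forall r, Rabs r < 1 -> 0 < D r)
    by (intros r Hr; apply poisson_denominator_pos; [apply COS_bound|exact Hr]).
  assert (HF : forall r, Rabs r < 1 -> is_derive F r 0).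
  { intros r Hr.
    set (A' := PSeries (PS_derive (binomial_cos lam theta)) r).
    set (B' := PSeries (PS_derive (binomial_sin lam theta)) r).
    assert (HA : is_derive A r A')
      by apply is_derive_PSeries, (cv_on_disk_binomial_cos lam theta Hlam r Hr).
    assert (HB : is_derive B r B')
      by apply is_derive_PSeries, (cv_on_disk_binomial_sin lam theta Hlam r Hr).
    destruct (binomial_rotation_ode lam theta r Hlam Hr) as [E1 E2].
    fold A B A' B' in E1, E2.
    assert (HDr := HD r Hr).
    assert (E : (A r * A' + B r * B') * D r
                = lam * (cos theta - r) * (A r ^ 2 + B r ^ 2)).
    { set (c := cos theta) in *. set (s := sin theta) in *.
      assert (Hcs : s ^ 2 = 1 - c ^ 2).
      { assert (H := sin2_cos2 theta). unfold Rsqr in H. fold c s in H. lra. }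
      assert (Ep : A' * (1 - r * c) + r * s * B' = lam * (c * A r - s * B r)) by lra.
      assert (Eq : B' * (1 - r * c) - r * s * A' = lam * (s * A r + c * B r)) by lra.
      (* Cramer's rule for the linear system Ep, Eq in A' and B', whose
         determinant is D. *)
      transitivity (A r * ((1 - r * c) * (A' * (1 - r * c) + r * s * B')
                           - r * s * (B' * (1 - r * c) - r * s * A'))
                  + B r * ((1 - r * c) * (B' * (1 - r * c) - r * s * A')
                           + r * s * (A' * (1 - r * c) + r * s * B'))).
      - replace (D r) with ((1 - r * c) ^ 2 + r ^ 2 * s ^ 2)
          by (rewrite Hcs; unfold D; ring).
        ring.
      - rewrite Ep, Eq.
        transitivity (lam * (A r ^ 2 + B r ^ 2) * (c - r * (c ^ 2 + s ^ 2)));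
          [ring | rewrite Hcs; ring]. }
    unfold F, Rpower.
    clearbody A B A' B'.
    assert (EA := is_derive_unique _ _ _ HA). assert (EB := is_derive_unique _ _ _ HB).
    unfold D in *. auto_derive.
    - repeat split; [exists A'; exact HA | exists B'; exact HB | lra].
    - replace (Derive (fun x0 => A x0) r) with A' by (symmetry; exact EA).
      replace (Derive (fun x0 => B x0) r) with B' by (symmetry; exact EB).
      set (d := 1 + - (2 * cos theta * r) + r * (r * 1)).
      replace (1 - 2 * cos theta * r + r ^ 2) with d in HDr, E by (unfold d; ring).
      transitivity (2 * exp (lam * ln d)
        * ((A r * A' + B r * B')
           + lam * (r - cos theta) * (A r ^ 2 + B r ^ 2) / d)).
      { field. lra. }
      replace (A r * A' + B r * B')
        with (lam * (cos theta - r) * (A r ^ 2 + B r ^ 2) / d)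
        by (rewrite <- E; field; lra).
      field. lra. }
  intro Hx.
  assert (HF0 : F x = F 0).
  { assert (Hr : Rabs x < 1) by exact Hx. apply Rabs_def2 in Hr.
    destruct (Rtotal_order x 0) as [H | [-> | H]]; [|reflexivity|symmetry];
      apply (eq_is_derive (V := R_NormedModule) F); try exact H;
      intros r Hr'; apply HF, Rabs_def1; lra. }
  assert (E0 : F 0 = 1).
  { unfold F, A, B, D. rewrite !PSeries_0.
    unfold binomial_cos, binomial_sin. simpl (INR 0).
    rewrite Rmult_0_l, cos_0, sin_0. simpl (binomial_coef lam 0).
    replace (1 - 2 * cos theta * 0 + 0 ^ 2) with 1 by ring.
    unfold Rpower. rewrite ln_1, (Rmult_0_r lam), exp_0. ring. }
  rewrite E0 in HF0. unfold F in HF0.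
  rewrite Rpower_Ropp.
  assert (Hp : 0 < Rpower (D x) lam) by apply exp_pos.
  change ((A x ^ 2 + B x ^ 2) = / Rpower (D x) lam).
  apply Rmult_eq_reg_r with (Rpower (D x) lam); [|lra].
  rewrite HF0. field. lra.
Qed.

(** [A^2 + B^2] is the sum of the Cauchy products on the whole disk, so its
    coefficients are the Taylor coefficients at [0] of the generating function
    and their series has radius at least [1]. *)
Lemma gegenbauer_generating_function (lam theta : R) :
  0 < lam ->
  cv_on_disk (fun l => gegenbauer lam l (cos theta)) /\
  forall x, Rabs x < 1 ->
    PSeries (fun l => gegenbauer lam l (cos theta)) x
    = Rpower (1 - 2 * cos theta * x + x ^ 2) (- lam).
Proof.
  intro Hlam.
  set (al := binomial_cos lam theta). set (be := binomial_sin lam theta).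
  set (c := PS_plus (PS_mult al al) (PS_mult be be)).
  assert (Hal : cv_on_disk al) by apply cv_on_disk_binomial_cos, Hlam.
  assert (Hbe : cv_on_disk be) by apply cv_on_disk_binomial_sin, Hlam.
  assert (Hex : forall x, Rabs x < 1 ->
            ex_pseries (PS_mult al al) x /\ ex_pseries (PS_mult be be) x)
    by (intros x Hx; split; apply ex_pseries_mult; auto).
  assert (Hc : cv_on_disk c).
  { apply cv_on_disk_of_segment. intros x Hx.
    apply (ex_pseries_plus (K := R_AbsRing) (V := R_NormedModule));
      apply Hex; rewrite Rabs_pos_eq; lra. }
  assert (Hval : forall x, Rabs x < 1 ->
            PSeries c x = Rpower (1 - 2 * cos theta * x + x ^ 2) (- lam)).
  { intros x Hx. unfold c. destruct (Hex x Hx).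
    rewrite PSeries_plus, !PSeries_mult by auto.
    rewrite <- binomial_modulus by assumption. fold al be. ring. }
  assert (Hgeg : forall l, gegenbauer lam l (cos theta) = c l).
  { intro l. unfold gegenbauer.
    rewrite (Derive_n_ext_loc _ (PSeries c)).
    - rewrite Derive_n_coef.
      + field. apply INR_fact_neq_0.
      + specialize (Hc 0). rewrite Rabs_R0 in Hc. apply Hc. lra.
    - exists (mkposreal 1 Rlt_0_1). intros y Hy.
      change (Rabs (y - 0) < 1) in Hy. rewrite Rminus_0_r in Hy.
      symmetry. apply Hval, Hy. }
  split.
  - apply cv_on_disk_le with (2 := Hc). intro l. rewrite Hgeg. apply Rle_refl.
  - intros x Hx. rewrite <- (Hval x Hx). apply PSeries_ext, Hgeg.
Qed.

(** Apply [1 + (x / lam) d/dx] to [D^(- lam)], where [D = 1 - 2 t x + x^2]: the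
    result is [D^(- lam - 1) (D - x (2 x - 2 t)) = D^(- lam - 1) (1 - x^2)]. *)
Lemma is_pseries_poisson (lam theta x : R) :
  0 < lam -> Rabs x < 1 ->
  is_pseries (fun l => (lam + INR l) / lam * gegenbauer lam l (cos theta)) x
    ((1 - x ^ 2) * Rpower (1 - 2 * cos theta * x + x ^ 2) (- lam - 1)).
Proof.
  intros Hlam Hx.
  destruct (gegenbauer_generating_function lam theta Hlam) as [Hc Hval].
  set (c := fun l => gegenbauer lam l (cos theta)) in *.
  assert (HD : 0 < 1 - 2 * cos theta * x + x ^ 2)
    by (apply poisson_denominator_pos; [apply COS_bound|exact Hx]).
  assert (Hder : PSeries (PS_derive c) x
    = - lam * (2 * x - 2 * cos theta)
      * Rpower (1 - 2 * cos theta * x + x ^ 2) (- lam - 1)).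
  { rewrite <- Derive_PSeries by (apply Hc, Hx).
    apply is_derive_unique.
    apply is_derive_ext_loc
      with (fun r => Rpower (1 - 2 * cos theta * r + r ^ 2) (- lam)).
    { assert (He : 0 < 1 - Rabs x) by lra.
      exists (mkposreal _ He). intros y Hy.
      change (Rabs (y - x) < 1 - Rabs x) in Hy. symmetry. apply Hval.
      replace y with ((y - x) + x) by ring.
      apply Rle_lt_trans with (1 := Rabs_triang _ _). lra. }
    replace (- lam - 1) with (- lam + - (1)) by ring.
    rewrite Rpower_plus, (Rpower_Ropp _ 1), Rpower_1 by exact HD.
    unfold Rpower. auto_derive; [lra|].
    replace (1 + - (2 * cos theta * x) + x * (x * 1))
      with (1 - 2 * cos theta * x + x ^ 2) by ring.
    field. lra. }
  apply is_pseries_ext with (PS_scal (/ lam) (fun l => (lam + INR l) * c l)).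
  { intro l. change (/ lam * ((lam + INR l) * c l) = (lam + INR l) / lam * c l).
    field. lra. }
  replace ((1 - x ^ 2) * _) with
    (/ lam * (lam * PSeries c x + x * PSeries (PS_derive c) x)).
  { exact (is_pseries_scal (/ lam) _ x _ (Rmult_comm _ _)
             (is_pseries_euler c lam x (Hc x Hx))). }
  rewrite Hder, (Hval x Hx).
  replace (Rpower (1 - 2 * cos theta * x + x ^ 2) (- lam))
    with (Rpower (1 - 2 * cos theta * x + x ^ 2) (- lam - 1)
          * (1 - 2 * cos theta * x + x ^ 2)).
  { field. lra. }
  rewrite <- (Rpower_1 (1 - 2 * cos theta * x + x ^ 2)) at 2 by exact HD.
  rewrite <- Rpower_plus. f_equal. ring.
Qed.

(** * The area of the sphere *)

Lemma sqrt_pow_le_exp (m : nat) (x : R) :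
  0 <= x -> sqrt x ^ m <= (2 * INR (S m)) ^ m * exp (x / 2).
Proof.
  intro Hx.
  assert (HS : 1 <= INR (S m)) by (rewrite S_INR; assert (H := pos_INR m); lra).
  assert (Hs : sqrt x <= 1 + x).
  { assert (H := sqrt_sqrt x Hx). assert (H' := sqrt_pos x). nra. }
  (* sqrt x <= 1 + x <= 2 (m+1) exp (x / (2 (m+1))), then take m-th powers. *)
  set (y := x / (2 * INR (S m))).
  assert (Hy : 0 <= y) by (apply Rdiv_le_0_compat; lra).
  assert (Hxy : x = 2 * INR (S m) * y) by (unfold y; field; lra).
  assert (He := exp_ineq1_le y).
  apply Rle_trans with ((2 * INR (S m) * exp y) ^ m).
  - apply pow_incr. split; [apply sqrt_pos|].
    apply Rle_trans with (1 := Hs). rewrite Hxy at 1. nra.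
  - rewrite Rpow_mult_distr. apply Rmult_le_compat_l; [apply pow_le; lra|].
    rewrite <- (Rpower_pow m (exp y)) by apply exp_pos.
    unfold Rpower. rewrite ln_exp.
    apply Rnot_lt_le. intro H. apply exp_lt_inv in H.
    rewrite Hxy, S_INR in H. lra.
Qed.

(** The Gamma integral at [m / 2 + 1].  Writing [x^(m/2)] as [sqrt x ^ m] makes
    the integrand continuous on the whole line, so only the upper end is improper;
    there the primitive is increasing and bounded by that of a multiple of
    [exp (- x / 2)]. *)
Lemma gamma_integral_half_integer_pos (m : nat) :
  exists l, 0 < l /\
    is_RInt_gen (fun x => Rpower x (INR m / 2) * exp (- x))
      (at_right 0) (Rbar_locally p_infty) l.
Proof.
  set (f := fun x => sqrt x ^ m * exp (- x)).
  set (F := fun x => RInt f 0 x).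
  assert (Hf : forall x, continuous f x).
  { intro x. apply (continuous_mult (fun x => sqrt x ^ m)).
    - apply (continuous_comp sqrt (fun y => y ^ m)); [apply continuous_sqrt|].
      apply continuity_pt_filterlim, derivable_continuous_pt, derivable_pt_pow.
    - apply continuity_pt_filterlim. apply derivable_continuous_pt.
      reg. }
  assert (Hint : forall a b, ex_RInt f a b)
    by (intros a b; apply (ex_RInt_continuous (V := R_CompleteNormedModule));
        intros; apply Hf).
  assert (Hpos : forall x, 0 < x -> 0 < f x).
  { intros x Hx. apply Rmult_lt_0_compat; [|apply exp_pos].
    apply pow_lt, sqrt_lt_R0, Hx. }
  assert (Hdiff : forall a b, F b - F a = RInt f a b).
  { intros a b. unfold F.
    assert (H := RInt_Chasles f 0 a b (Hint 0 a) (Hint a b)).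
    change (RInt f 0 a + RInt f a b = RInt f 0 b) in H.
    rewrite <- H. ring. }
  assert (Hmono : forall a b, 0 <= a <= b -> F a <= F b).
  { intros a b [Ha [Hab | <-]]; [|lra].
    assert (H : 0 < RInt f a b).
    { apply RInt_gt_0; [exact Hab | | intros; apply Hf].
      intros x Hx. apply Hpos. lra. }
    rewrite <- Hdiff in H. lra. }
  set (M := (2 * INR (S m)) ^ m).
  assert (Hbound : forall b, 0 <= b -> F b <= 2 * M).
  { intros b Hb. unfold F.
    apply Rle_trans with (- 2 * M * exp (- (b / 2)) - - 2 * M * exp (- (0 / 2))).
    - assert (HI : is_RInt (fun x => M * exp (- (x / 2))) 0 b
               (minus (- 2 * M * exp (- (b / 2))) (- 2 * M * exp (- (0 / 2))))).
      { apply (is_RInt_derive (fun x => - 2 * M * exp (- (x / 2)))).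
        - intros x _. auto_derive; [exact I|].
          match goal with |- ?u = ?v => change (@eq R u v) end. unfold Rdiv. field.
        - intros x _. apply continuity_pt_filterlim, derivable_continuous_pt. reg. }
      change (RInt f 0 b <= minus (- 2 * M * exp (- (b / 2))) (- 2 * M * exp (- (0 / 2)))).
      rewrite <- (is_RInt_unique _ _ _ _ HI).
      apply RInt_le; [exact Hb | apply Hint | eexists; exact HI |].
      intros x Hx. unfold f.
      replace (- (x / 2)) with (x / 2 + - x) by field.
      rewrite exp_plus, <- Rmult_assoc.
      apply Rmult_le_compat_r; [left; apply exp_pos|].
      apply sqrt_pow_le_exp. lra.
    - replace (- (0 / 2)) with 0 by field. rewrite exp_0.
      assert (H1 := exp_pos (- (b / 2))).
      assert (H2 : 0 <= M)
        by (apply pow_le; assert (H := pos_INR (S m)); lra).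
      nra. }
  destruct (completeness (fun y => exists b, 0 <= b /\ y = F b)) as [l [Hub Hlub]].
  { exists (2 * M). intros y [b [Hb ->]]. apply Hbound, Hb. }
  { exists (F 0), 0. split; [lra | reflexivity]. }
  assert (HF0 : F 0 = 0) by apply (RInt_point (V := R_CompleteNormedModule)).
  exists l. split.
  - apply Rlt_le_trans with (F 1).
    + unfold F. apply RInt_gt_0; [lra | | intros; apply Hf].
      intros x Hx. apply Hpos. lra.
    + apply Hub. exists 1. split; [lra | reflexivity].
  - assert (Hlim0 : filterlim F (at_right 0) (locally 0)).
    { rewrite <- HF0 at 2.
      apply (filterlim_filter_le_1 (F := locally 0)); [apply filter_le_within|].
      apply (continuous_RInt_1 f 0 0 F).
      apply filter_forall. intro z. apply (RInt_correct f), Hint. }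
    assert (Hlim1 : filterlim F (Rbar_locally p_infty) (locally l)).
    { apply filterlim_locally. intro eps.
      assert (H : exists b, 0 <= b /\ l - eps < F b).
      { apply Classical_Prop.NNPP. intro H.
        assert (l <= l - eps).
        { apply Hlub. intros y [b [Hb ->]].
          apply Rnot_lt_le. intro H'. apply H. exists b. tauto. }
        assert (He := cond_pos eps). lra. }
      destruct H as [b [Hb Hlb]]. exists b. intros x Hx.
      change (Rabs (F x - l) < eps).
      assert (H1 := Hmono b x).
      assert (H2 : F x <= l) by (apply Hub; exists x; split; [lra | reflexivity]).
      apply Rabs_def1; lra. }
    replace l with (l - 0) by ring.
    apply (is_RInt_gen_ext f).
    { exists (fun a => 0 < a) (fun b => 0 < b).
      - exists (mkposreal 1 Rlt_0_1). tauto.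
      - exists 0. tauto.
      - intros a b Ha Hb x Hx. simpl in Hx.
        assert (Hx0 : 0 < x).
        { destruct Hx as [Hx _]. apply Rle_lt_trans with (2 := Hx).
          apply Rmin_glb; lra. }
        unfold f. f_equal.
        rewrite <- Rpower_pow by (apply sqrt_lt_R0, Hx0).
        rewrite <- Rpower_sqrt, Rpower_mult by exact Hx0. f_equal. field. }
    intros P HP.
    assert (HG : filterlim (fun ab : R * R => F (snd ab) - F (fst ab))
              (filter_prod (at_right 0) (Rbar_locally p_infty)) (locally (l - 0))).
    { apply (filterlim_comp_2 (G := locally l) (H := locally 0)
               (fun ab : R * R => F (snd ab)) (fun ab => F (fst ab)) Rminus).
      - apply filterlim_comp with (2 := Hlim1). apply filterlim_snd.
      - apply filterlim_comp with (2 := Hlim0). apply filterlim_fst.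
      - apply (filterlim_comp_2 (G := locally l) (H := locally (opp 0))
                 (fun z : R * R => fst z) (fun z => opp (snd z)) plus).
        + apply filterlim_fst.
        + apply filterlim_comp with (1 := filterlim_snd).
          apply (filterlim_opp 0).
        + apply (filterlim_plus l (opp 0)). }
    specialize (HG P HP). unfold filtermap in HG.
    apply filter_imp with (2 := HG). intros [a b] Hab. simpl in *.
    exists (F b - F a). split; [|exact Hab].
    rewrite Hdiff. apply (RInt_correct f), Hint.
Qed.

Lemma sphere_area_neq_0 (n : nat) : (1 <= n)%nat -> sphere_area n <> 0.
Proof.
  intro Hn. destruct (gamma_integral_half_integer_pos (n - 1)) as [l [Hl HG]].
  assert (E : Defs.Gamma ((INR n + 1) / 2) = l).
  { apply is_RInt_gen_unique.
    replace ((INR n + 1) / 2 - 1) with (INR (n - 1) / 2)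
      by (rewrite minus_INR by exact Hn; simpl (INR 1); field).
    exact HG. }
  unfold sphere_area. rewrite E.
  apply Rgt_not_eq, Rdiv_lt_0_compat; [|exact Hl].
  apply Rmult_lt_0_compat; [lra | apply exp_pos].
Qed.

(** * Integrals of the Poisson kernel *)

Definition poisson_coef (n : nat) (t : R) (l : nat) : R :=
  (lambda n + INR l) / lambda n * gegenbauer (lambda n) l t.

Lemma lambda_pos (n : nat) : (2 <= n)%nat -> 0 < lambda n.
Proof.
  intro Hn. apply le_INR in Hn. simpl in Hn. unfold lambda. lra.
Qed.

(** Away from the pole, which [0 < theta] excludes, the kernel tends to [0] at
    [r = 1]; the coefficient of index [0], removed here, is [1].  Hence the Abel
    sum [-1]. *)
Lemma abel_sum_poisson_tail (n : nat) (theta : R) :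
  (2 <= n)%nat -> 0 < theta <= PI ->
  is_abel_sum (PS_decr_1 (poisson_coef n (cos theta))) (-1) /\
  forall r, 0 < r < 1 ->
    sphere_area n * poisson n r (cos theta) - 1
    = r * PSeries (PS_decr_1 (poisson_coef n (cos theta))) r.
Proof.
  intros Hn Htheta.
  assert (Hlam := lambda_pos n Hn).
  set (t := cos theta). set (w := poisson_coef n t).
  set (W := fun r => (1 - r ^ 2) * Rpower (1 - 2 * t * r + r ^ 2) (- lambda n - 1)).
  assert (Hw : forall r, Rabs r < 1 -> is_pseries w r (W r))
    by (intros r Hr; apply is_pseries_poisson; assumption).
  assert (Hw0 : w O = 1).
  { rewrite <- PSeries_0.
    rewrite (is_pseries_unique _ _ _ (Hw 0 ltac:(rewrite Rabs_R0; lra))).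
    unfold W, Rpower. replace (1 - 2 * t * 0 + 0 ^ 2) with 1 by ring.
    rewrite ln_1, (Rmult_0_r (- lambda n - 1)), exp_0. ring. }
  assert (Hdecr : forall r, Rabs r < 1 -> W r = 1 + r * PSeries (PS_decr_1 w) r).
  { intros r Hr. rewrite <- Hw0.
    rewrite <- (is_pseries_unique _ _ _ (Hw r Hr)).
    apply PSeries_decr_1. exists (W r). apply Hw, Hr. }
  assert (Hcv : cv_on_disk (PS_decr_1 w)).
  { intros x Hx. rewrite CV_radius_decr_1. revert x Hx.
    apply cv_on_disk_of_segment. intros x Hx. exists (W x). apply Hw.
    rewrite Rabs_pos_eq; lra. }
  assert (Ht : t < 1).
  { unfold t. rewrite <- cos_0. apply cos_decreasing_1; lra. }
  split; [split|].
  - intros x Hx. apply CV_radius_inside, Hcv. rewrite Rabs_pos_eq; lra.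
  - apply filterlim_ext_loc with (fun r => (W r - 1) / r).
    { apply at_left_1_interval. intros r Hr.
      rewrite Hdecr by (rewrite Rabs_pos_eq; lra). field. lra. }
    apply (filterlim_filter_le_1 (F := locally 1)); [apply filter_le_within|].
    replace (-1) with ((W 1 - 1) / 1) by (unfold W; field).
    apply (ex_derive_continuous (fun r => (W r - 1) / r)).
    unfold W, Rpower. auto_derive. repeat split; [nra | lra].
  - intros r Hr. unfold poisson.
    rewrite <- Rmult_assoc, Rinv_r, Rmult_1_l by (apply sphere_area_neq_0; lia).
    transitivity (PSeries w r - 1).
    + f_equal. apply Series_ext. intro l. unfold w, poisson_coef. ring.
    + assert (Hr' : Rabs r < 1) by (rewrite Rabs_pos_eq; lra).
      rewrite (is_pseries_unique _ _ _ (Hw r Hr')), (Hdecr r Hr'). ring.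
Qed.

(** The index is shifted by one: [a j] is the coefficient of degree
    [l = j + 1], so the denominators are [l + k]. *)
Lemma abel_sum_I_J (n k : nat) (theta : R) :
  (2 <= n)%nat -> 0 < theta <= PI ->
  let a := PS_decr_1 (poisson_coef n (cos theta)) in
  ex_RInt (I_integrand n (INR k) (cos theta)) 0 1 /\
  ex_RInt (J_integrand n (INR k) (cos theta)) 0 1 /\
  is_abel_sum (fun j => a j / (INR k + 1 + INR j)) (I_int n (INR k) (cos theta)) /\
  is_abel_sum (fun j => a j / (INR k + 1 + INR j) / (INR k + 1 + INR j))
    (J_int n (INR k) (cos theta)).
Proof.
  intros Hn Htheta a.
  destruct (abel_sum_poisson_tail n theta Hn Htheta) as [Ha Htail].
  destruct (abel_sum_integrated a _ k (I_integrand n (INR k) (cos theta)) Ha)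
    as [HexI [HI HabI]].
  { intros r Hr. unfold I_integrand. rewrite (Htail r Hr).
    rewrite <- (Rpower_pow k r) by lra.
    rewrite <- Rmult_assoc. fold a. f_equal.
    (* The factor r of the bracket turns the exponent k - 1 into k, so that
       k = 0 gives an integrand bounded near 0. *)
    rewrite <- (Rpower_1 r) at 2 by lra.
    rewrite <- Rpower_plus. f_equal. ring. }
  destruct (abel_sum_integrated _ _ k (J_integrand n (INR k) (cos theta)) HabI)
    as [HexJ [_ HabJ]].
  { intros r Hr. unfold J_integrand. rewrite (HI r Hr). simpl. field. lra. }
  tauto.
Qed.

Theorem theorem4p4 (n : nat) (hn : (2 <= n)%nat)
    (theta : R) (htheta : 0 < theta <= PI) :
  (forall k : R, k = 0 \/ k = 2 * lambda n ->
     ex_RInt (I_integrand n k (cos theta)) 0 1 /\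
     ex_RInt (J_integrand n k (cos theta)) 0 1) /\
  is_G0_value n (cos theta)
    (1 / (4 * lambda n ^ 2)
       * (J_int n 0 (cos theta) + J_int n (2 * lambda n) (cos theta))
     - 1 / (4 * lambda n ^ 3)
       * (I_int n 0 (cos theta) - I_int n (2 * lambda n) (cos theta))).
Proof.
  assert (Hlam := lambda_pos n hn).
  assert (E : 2 * lambda n = INR (n - 1)).
  { rewrite minus_INR by lia. unfold lambda. simpl (INR 1). field. }
  destruct (abel_sum_I_J n 0 theta hn htheta) as [HexI0 [HexJ0 [HI0 HJ0]]].
  destruct (abel_sum_I_J n (n - 1) theta hn htheta) as [HexI1 [HexJ1 [HI1 HJ1]]].
  rewrite <- E in *. simpl (INR 0) in *.
  split.
  - intros k [-> | ->]; auto.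
  - enough (HG : is_abel_sum (G0_term n (cos theta))
      (1 / (4 * lambda n ^ 2)
         * (J_int n 0 (cos theta) + J_int n (2 * lambda n) (cos theta))
       - 1 / (4 * lambda n ^ 3)
         * (I_int n 0 (cos theta) - I_int n (2 * lambda n) (cos theta)))).
    { split; [exact HG|]. intros s'. apply abel_sum_of_series, HG. }
    assert (HJ := is_abel_sum_linear _ _ _ _ 1 1 HJ0 HJ1).
    assert (HI := is_abel_sum_linear _ _ _ _ 1 (-1) HI0 HI1).
    assert (H := is_abel_sum_incr_1 _ _
      (is_abel_sum_linear _ _ _ _
         (1 / (4 * lambda n ^ 2)) (- (1 / (4 * lambda n ^ 3))) HJ HI)).
    clear - H Hlam.
    match type of H with is_abel_sum _ ?s =>
      replace (_ - _) with s by ring end.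
    apply is_abel_sum_ext with (2 := H).
    intros [|j]; [reflexivity|].
    (* What remains is the partial fraction identity at l = j + 1. *)
    unfold PS_incr_1, PS_decr_1, poisson_coef, G0_term.
    assert (Hj := pos_INR j). rewrite S_INR. field. lra.
Qed.
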